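(* Let $\Gamma$ be a finite, simple, connected, undirected, regular graph with adjacency matrix $A$, diameter $2$ and exactly $4$ distinct eigenvalues. Then $\mathcal{A}=\operatorname{span}\{I,A,A^2,A^3\}$ is closed under Hadamard multiplication if and only if either (i) or (ii) holds: (i) any two nonadjacent (distinct) vertices have a constant number of common neighbours, and the number of common neighbours of two adjacent vertices takes precisely two values; (ii) any two adjacent vertices have a constant number of common neighbours, and the number of common neighbours of two nonadjacent (distinct) vertices takes precisely two values.
   Context: Hadamard multiplication is entrywise multiplication of matrices. *)

(* Defs.v *)
From HB Require Import structures.
From mathcomp Require Import all_boot all_order all_algebra.
Set Implicit Arguments.
Unset Strict Implicit.
Unset Printing Implicit Defensive.

Import Order.TTheory GRing.Theory Num.Theory.
Local Open Scope ring_scope.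

Section Graph.
Variables (T : finType) (e : rel T).

Definition simple_graph : Prop := symmetric e /\ irreflexive e.

Definition connected_graph : Prop := forall x y : T, connect e x y.

Definition regular_graph : Prop :=
  exists k : nat, forall x : T, #|[set y | e x y]| = k.

Definition walk_of_length (k : nat) (x y : T) : bool :=
  [exists p : k.-tuple T, path e x p && (last x p == y)].

(* The length of a shortest walk from x to y.  A shortest walk has fewer than
   #|T| edges, so only such lengths are searched; the junk value #|T| is
   returned when y is not reachable from x. *)
Definition graph_dist (x y : T) : nat :=
  find (fun k => walk_of_length k x y) (iota 0 #|T|).

Definition diameter : nat := (\max_(x : T) \max_(y : T) graph_dist x y)%N.

Definition nonadjacent : rel T := [rel x y | (x != y) && ~~ e x y].

Definition common_neighbours (x y : T) : nat := #|[set z | e x z && e y z]|.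

Definition constant_on (r : rel T) (f : T -> T -> nat) : Prop :=
  exists c : nat, forall x y, r x y -> f x y = c.

Definition takes_two_values_on (r : rel T) (f : T -> T -> nat) : Prop :=
  exists a b : nat, a <> b /\
    forall v : nat, (exists x y, r x y /\ f x y = v) <-> (v = a \/ v = b).

End Graph.

Definition adjacency_matrix (R : nzRingType) (T : finType) (e : rel T) :
    'M[R]_#|T| :=
  \matrix_(i, j) (e (enum_val i) (enum_val j))%:R.

Definition num_distinct_eigenvalues (F : fieldType) (n : nat) (A : 'M[F]_n)
    (m : nat) : Prop :=
  exists s : seq F,
    [/\ uniq s, size s = m & forall a : F, eigenvalue A a <-> a \in s].

Definition hadamard (R : pzRingType) (m n : nat) (M N : 'M[R]_(m, n)) :
    'M[R]_(m, n) :=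
  map2_mx *%R M N.

Definition hadamard_closed (F : fieldType) (n : nat)
    (V : {vspace 'M[F]_n}) : Prop :=
  forall M N : 'M[F]_n, M \in V -> N \in V -> hadamard M N \in V.

(* Main.v *)
Require Import Defs.
From HB Require Import structures.
From mathcomp Require Import all_boot all_order all_algebra.
From mathcomp Require Import spectral complex ring.
Set Implicit Arguments.
Unset Strict Implicit.
Unset Printing Implicit Defensive.

Import Order.TTheory GRing.Theory Num.Theory.
Local Open Scope ring_scope.

(** Write [k] for the valency and [V] for the span of [1, A, A^2, A^3]. Being
real symmetric, [A] is annihilated by [\prod_a (A - a)] over its four
eigenvalues, so the product over the three eigenvalues other than [k] is a
nonzero multiple of the all-ones matrix [J], which therefore lies in [V].
Partition the ordered pairs of vertices into the diagonal and the classes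
"adjacent with [c] common neighbours" and "nonadjacent with [c] common
neighbours". The indicator matrices of the nonempty classes are linearly
independent and [\dim V <= 4].

If [V] is Hadamard closed, interpolation on the entries of [A^2] puts every
class indicator in [V], so there are at most three off-diagonal classes. There
cannot be just two, because then [A^2] is a combination of [1, A, J] and the
three eigenvalues other than [k] are roots of one quadratic. Conversely, (i)
and (ii) give four classes whose indicators are combinations of
[1, A, A^2, J]; hence they form a basis of [V], and their span is Hadamard
closed. *)

(** * Annihilation of a real symmetric matrix by its eigenvalues *)

Lemma mul_eigenvector_prod (R : comNzRingType) (n : nat) (A : 'M[R]_n)
    (v : 'rV_n) (a : R) (s : seq R) :
  v *m A = a *: v ->
  v *m \prod_(b <- s) (A - b%:M) = (\prod_(b <- s) (a - b)) *: v.
Proof.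
move=> Av; elim: s => [|b s IHs]; first by rewrite !big_nil mulmx1 scale1r.
rewrite !big_cons mulmxA mulmxBr Av mul_mx_scalar -scalerBl -scalemxAl IHs.
by rewrite scalerA.
Qed.

Lemma map_mx_prod_subr (R S : comNzRingType) (f : {rmorphism R -> S}) (n : nat)
    (A : 'M[R]_n) (s : seq R) :
  map_mx f (\prod_(b <- s) (A - b%:M)) = \prod_(b <- s) (map_mx f A - (f b)%:M).
Proof.
elim: s => [|b s IHs]; first by rewrite !big_nil map_mx1.
by rewrite !big_cons map_mxM map_mxB map_scalar_mx IHs.
Qed.

(** Over [R[i]] the matrix is Hermitian, so it is diagonalised by [P] with real diagonal entries,
    which are eigenvalues of [A]. Each row of [P] is killed by the product because one factor
    vanishes on it, and [P] is invertible. *)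
Lemma symmetric_eigenvalue_prod0 (R : rcfType) (n : nat) (A : 'M[R]_n)
    (s : seq R) :
  A^T = A -> (forall a, eigenvalue A a -> a \in s) ->
  \prod_(b <- s) (A - b%:M) = 0.
Proof.
move=> symA eigA; pose f : {rmorphism R -> R[i]} := real_complex R.
pose B := map_mx f A.
have hermB : B \is hermsymmx.
  apply: realsym_hermsym.
    by apply/is_hermitianmxP; rewrite expr0 scale1r map_mx_id // map_trmx symA.
  apply/mxOverP => i j; rewrite mxE; apply/complex_realP.
  by exists (A i j).
have /orthomx_spectralP Bspec := hermitian_normalmx hermB.
have Punit := spectral_unit B.
set P := spectralmx B in Bspec Punit; set d := spectral_diag B in Bspec.
have PB : P *m B = diag_mx d *m P by rewrite {1}Bspec -mulmxA mulKVmx.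
have dreal i : d 0 i = f (complex.Re (d 0 i)).
  rewrite [RHS]RRe_real //.
  exact: (mxOverP (hermitian_spectral_diag_real hermB)).
have rowPB i : row i P *m B = d 0 i *: row i P.
  by rewrite -row_mul PB row_mul row_diag_mx -scalemxAl -rowE.
have dA i : complex.Re (d 0 i) \in s.
  apply: eigA; rewrite -(eigenvalue_map f) -dreal; apply/eigenvalueP.
  exists (row i P); first exact: rowPB.
  apply: contraTneq Punit => Pi0; rewrite -row_free_unit.
  apply/negP => /row_freeP[Q PQ]; have := congr1 (row i) PQ.
  rewrite row_mul Pi0 mul0mx row1 => /matrixP/(_ 0 i)/eqP.
  by rewrite !mxE !eqxx eq_sym oner_eq0.
apply: (map_mx_inj (f := f)); rewrite map_mx_prod_subr -/B map_mx0.
rewrite -(big_map f predT (fun b => B - b%:M)) /=.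
apply: (can_inj (mulKmx Punit)); rewrite mulmx0; apply/row_matrixP => i.
rewrite row_mul (mul_eigenvector_prod _ (rowPB i)) row0.
suff -> : \prod_(b <- [seq f b | b <- s]) (d 0 i - b) = 0 by rewrite scale0r.
apply/eqP; rewrite prodf_seq_eq0; apply/hasP; exists (d 0 i).
  by rewrite dreal map_f.
by rewrite /= subrr.
Qed.

(** * Hadamard products and indicator matrices of classes of index pairs *)

Section LevelMatrices.
Variables (F : fieldType) (n : nat).

(** Lagrange interpolation: multiplying [N] entrywise by [M - b] for every entry [b] of [M] other
    than [a] kills the positions where [M] differs from [a] and scales the others by one nonzero
    constant. *)
Lemma hadamard_closed_level (V : {vspace 'M[F]_n}) (M N : 'M[F]_n) (a : F) :
  hadamard_closed V -> const_mx 1 \in V -> M \in V -> N \in V ->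
  \matrix_(i, j) (N i j * (M i j == a)%:R) \in V.
Proof.
move=> Vhad V1 VM VN.
have Vprod r : \matrix_(i, j) (N i j * \prod_(b <- r) (M i j - b)) \in V.
  elim: r => [|b r IHr].
    rewrite (_ : \matrix_(i, j) _ = N) //.
    by apply/matrixP => i j; rewrite mxE big_nil mulr1.
  have VMb : M - b *: const_mx 1 \in V by rewrite memvB ?memvZ.
  have := Vhad _ _ VMb IHr; congr (_ \in V); apply/matrixP => i j.
  by rewrite !mxE big_cons mulr1 mulrCA.
pose entries := [seq M p.1 p.2 | p : 'I_n * 'I_n].
pose r := [seq x <- entries | x != a].
have ra0 : \prod_(b <- r) (a - b) != 0.
  rewrite prodf_seq_neq0; apply/allP => b; rewrite mem_filter => /andP[ba _].
  by rewrite /= subr_eq0 eq_sym.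
have := memvZ (\prod_(b <- r) (a - b))^-1 (Vprod r).
congr (_ \in V); apply/matrixP => i j; rewrite !mxE mulrCA; congr (_ * _).
have [->|Ma] := eqVneq (M i j) a; first by rewrite mulVf.
rewrite (_ : \prod_(b <- r) (M i j - b) = 0) ?mulr0 //.
apply/eqP; rewrite prodf_seq_eq0; apply/hasP; exists (M i j).
  by rewrite mem_filter Ma; apply/mapP; exists (i, j); rewrite ?mem_enum.
by rewrite /= subrr.
Qed.

Variables (K : eqType) (key : 'I_n -> 'I_n -> K).

Definition level_mx (c : K) : 'M[F]_n := \matrix_(i, j) (key i j == c)%:R.

(** Describing the span by functions of [key] makes both linear independence and closure under
    entrywise products immediate. *)
Lemma span_level_mxP (cs : seq K) (M : 'M[F]_n) :
  uniq cs ->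
  reflect (exists f : K -> F,
             forall i j, M i j = f (key i j) * (key i j \in cs)%:R)
          (M \in <<[seq level_mx c | c <- cs]>>%VS).
Proof.
move=> Ucs; apply: (iffP idP).
  elim: cs Ucs M => [|c cs IHcs] /=.
    move=> _ M; rewrite span_nil memv0 => /eqP->; exists (fun=> 0) => i j.
    by rewrite mxE mul0r.
  case/andP=> ccs Ucs M; rewrite span_cons.
  case/memv_addP=> _ /vlineP[a ->] [N /(IHcs Ucs)[f Nf] ->].
  exists (fun k => if k == c then a else f k) => i j; rewrite !mxE Nf inE.
  have [->|_] := eqVneq (key i j) c.
    by rewrite (negPf ccs) mulr0 addr0.
  by rewrite mulr0 add0r.
case=> f Mf; have -> : M = \sum_(c <- cs) f c *: level_mx c.
  apply/matrixP => i j; rewrite summxE Mf.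
  under eq_bigr do rewrite !mxE.
  have [kcs|kcs] := boolP (key i j \in cs).
    rewrite (bigD1_seq _ kcs Ucs) /= eqxx big1 ?addr0 // => c.
    by rewrite eq_sym => /negPf->; rewrite mulr0.
  rewrite mulr0 big_seq big1 // => c ccs.
  rewrite (_ : (key i j == c) = false) ?mulr0 //.
  by apply: contraNF kcs => /eqP->.
rewrite big_seq memv_suml // => c ccs.
by rewrite memvZ // memv_span // map_f.
Qed.

(** An indicator in the span of the others would vanish on its own class, which is nonempty by
    assumption; an empty class would have indicator zero. *)
Lemma free_level_mx (cs : seq K) :
  uniq cs -> (forall c, c \in cs -> exists i j, key i j = c) ->
  free [seq level_mx c | c <- cs].
Proof.
elim: cs => [|c cs IHcs] /=; first by rewrite nil_free.
case/andP=> ccs Ucs att; rewrite free_cons IHcs // ?andbT; last first.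
  by move=> c' c'cs; apply: att; rewrite inE c'cs orbT.
apply/negP => /(span_level_mxP _ Ucs)[f cf].
have [i [j ijc]] := att c (mem_head _ _).
have := cf i j; rewrite mxE ijc eqxx (negPf ccs) mulr0 => /eqP.
by rewrite oner_eq0.
Qed.

Lemma size_level_le_dim (V : {vspace 'M[F]_n}) (cs : seq K) :
  uniq cs -> (forall c, c \in cs -> exists i j, key i j = c) ->
  (forall c, c \in cs -> level_mx c \in V) -> (size cs <= \dim V)%N.
Proof.
move=> Ucs att Vcs; rewrite -(size_map level_mx).
rewrite -(eqP (free_level_mx Ucs att)) dimvS //.
by apply/span_subvP => _ /mapP[c ccs ->]; apply: Vcs.
Qed.

(** The independent indicators span [V] by the dimension bound, and functions of [key] are stable
    under multiplication. *)
Lemma level_hadamard_closed (V : {vspace 'M[F]_n}) (cs : seq K) :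
  uniq cs -> (forall c, c \in cs -> exists i j, key i j = c) ->
  (forall c, c \in cs -> level_mx c \in V) -> (\dim V <= size cs)%N ->
  hadamard_closed V.
Proof.
move=> Ucs att Vcs dimV.
have <- : <<[seq level_mx c | c <- cs]>>%VS = V.
  apply/eqP; rewrite eqEdim (eqP (free_level_mx Ucs att)) size_map dimV andbT.
  by apply/span_subvP => _ /mapP[c ccs ->]; apply: Vcs.
move=> M N /(span_level_mxP _ Ucs)[f Mf] /(span_level_mxP _ Ucs)[g Ng].
apply/(span_level_mxP _ Ucs); exists (fun k => f k * g k) => i j.
by rewrite mxE Mf Ng; case: (_ \in _); rewrite ?mulr0 ?mulr1.
Qed.

End LevelMatrices.

(** * Nonadjacent pairs and constancy *)

Lemma diameter_gt1 (T : finType) (e : rel T) :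
  (1 < diameter e)%N -> exists x y, nonadjacent e x y.
Proof.
move=> diam.
have [/existsP[x /existsP[y xy]]|none] :=
  boolP [exists x, exists y, nonadjacent e x y]; first by exists x, y.
suff: (diameter e <= 1)%N by rewrite leqNgt diam.
apply/bigmax_leqP => x _; apply/bigmax_leqP => y _.
have: ~~ nonadjacent e x y.
  by apply: contra none => xy; apply/existsP; exists x; apply/existsP; exists y.
rewrite leqNgt; apply: contra => dist2; rewrite /graph_dist in dist2.
(* [graph_dist] searches only lengths below [#|T|], so lengths 0 and 1 must be seen to lie in the
   searched range. *)
have card2 : (1 < #|T|)%N.
  by apply: leq_trans dist2 _; rewrite -{2}[#|T|](size_iota 0) find_size.
have nowalk k : (k < 2)%N -> ~~ walk_of_length e k x y.
  move=> k2; have kT := leq_trans k2 card2.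
  by have := before_find 0%N (leq_trans k2 dist2); rewrite nth_iota // => ->.
apply/andP; split.
  apply: contra (nowalk 0%N isT) => xy; apply/existsP; exists [tuple].
  by rewrite /= xy.
apply: contra (nowalk 1%N isT) => exy; apply/existsP; exists [tuple y].
by rewrite /= exy eqxx.
Qed.

(** Applied below with an attained value [a], so that the second alternative yields a second
    value. *)
Lemma constant_onVneq (T : finType) (r : rel T) (f : T -> T -> nat) (a : nat) :
  constant_on r f \/ exists x y, r x y /\ f x y <> a.
Proof.
have [/existsP[x /existsP[y /andP[xy /eqP fa]]]|none] :=
  boolP [exists x, exists y, r x y && (f x y != a)].
  by right; exists x, y.
left; exists a => x y xy; apply/eqP/negPn; apply: contra none => fa.
by apply/existsP; exists x; apply/existsP; exists y; rewrite xy.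
Qed.

(** * Adjacency matrix of a connected regular graph and Hoffman's polynomial *)

Section RegularGraph.
Variables (R : rcfType) (T : finType) (e : rel T) (k : nat).
Hypotheses (e_sym : symmetric e) (e_irr : irreflexive e).
Hypothesis e_conn : connected_graph e.
Hypothesis e_reg : forall x : T, #|[set y | e x y]| = k.

Local Notation A := (adjacency_matrix R e).
Local Notation V := (<<[:: 1%:M; A; A ^+ 2; A ^+ 3]>>%VS).
Local Notation cn := (common_neighbours e).

Lemma adjacency_trmx : A^T = A.
Proof. by apply/matrixP => i j; rewrite !mxE e_sym. Qed.

Lemma adjacency_sqrE i j : (A ^+ 2) i j = (cn (enum_val i) (enum_val j))%:R.
Proof.
rewrite expr2 -[A * A]/(A *m A) mxE /common_neighbours -sum1_card natr_sum.
rewrite [RHS]big_mkcond /= [RHS](reindex _ (onW_bij _ (enum_val_bij T))) /=.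
apply: eq_bigr => l _; rewrite !mxE inE [e (enum_val l) _]e_sym -natrM mulnb.
by case: (_ && _).
Qed.

Lemma common_neighbours_refl x : cn x x = k.
Proof.
by rewrite -(e_reg x); apply: eq_card => y; rewrite !inE andbb.
Qed.

Lemma adjacency_row_sum i : \sum_j A i j = k%:R.
Proof.
rewrite -(e_reg (enum_val i)) -sum1_card natr_sum [RHS]big_mkcond /=.
rewrite [RHS](reindex _ (onW_bij _ (enum_val_bij T))) /=.
by apply: eq_bigr => l _; rewrite mxE inE; case: (e _ _).
Qed.

Lemma adjacency_col_sum j : \sum_i A i j = k%:R.
Proof.
rewrite -(adjacency_row_sum j).
by apply: eq_bigr => i _; rewrite !mxE e_sym.
Qed.

Lemma adjacency_const1 : const_mx 1 *m A = k%:R *: const_mx 1 :> 'rV_#|T|.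
Proof.
apply/rowP => j; rewrite !mxE mulr1 -(adjacency_col_sum j).
by apply: eq_bigr => i _; rewrite mxE mul1r.
Qed.

(* At a maximal entry of [v], all neighbouring entries are maximal too. *)
Lemma adjacency_eigenvector_const (v : 'rV[R]_#|T|) i j :
  v *m A = k%:R *: v -> v 0 i = v 0 j.
Proof.
move=> vA.
pose m := [arg max_(l > i) v 0 l]%O.
have v_le l : v 0 l <= v 0 m by rewrite /m; case: arg_maxP => // l0 _; apply.
have step l : v 0 l = v 0 m ->
    forall l', e (enum_val l) (enum_val l') -> v 0 l' = v 0 m.
  move=> lm l' ll'; have /rowP/(_ l) := vA; rewrite !mxE => eqv.
  (* The eigenvector equation at [l] says that the gaps to the maximum over the neighbours of [l]
     sum to zero; being nonnegative, they all vanish. *)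
  have sum0 : \sum_h (v 0 m - v 0 h) * A h l = 0.
    under eq_bigr do rewrite mulrBl; rewrite sumrB eqv lm -mulr_sumr mulrC.
    by rewrite adjacency_col_sum subrr.
  have ge0 h : true -> 0 <= (v 0 m - v 0 h) * A h l.
    by move=> _; rewrite mulr_ge0 ?subr_ge0 // mxE ler0n.
  have := psumr_eq0P ge0 sum0 (i := l') isT.
  by rewrite mxE e_sym ll' mulr1 => /eqP; rewrite subr_eq0 => /eqP.
have all_max l : v 0 l = v 0 m.
  have /connectP[p] := e_conn (enum_val m) (enum_val l).
  (* The start of the path becomes any [h] where [v] is maximal, while the maximum [v 0 m] stays
     fixed for the induction. *)
  move: {1 3 4}m (erefl (v 0 m)) => h.
  elim: p h => [|x p IHp] h hm /=; first by move=> _ /enum_val_inj->.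
  case/andP=> hx; rewrite -[x]enum_rankK; apply: IHp.
  by apply: step hm _ _; rewrite enum_rankK.
by rewrite !all_max.
Qed.

Lemma span4_prod (s : seq R) :
  size s = 3%N -> \prod_(b <- s) (A - b%:M) \in V.
Proof.
case: s => [|a [|b [|c [|]]]] //= _; rewrite !big_cons big_nil mulr1.
have mulE (M N : 'M[R]_#|T|) : M * N = M *m N by [].
have Vx M : M \in [:: 1%:M; A; A ^+ 2; A ^+ 3] -> M \in V by apply: memv_span.
have V0 d : d%:M \in V by rewrite -[d%:M]scalemx1 memvZ // Vx // mem_head.
have V1 : A \in V by rewrite Vx // !inE eqxx orbT.
have V2 : A *m A \in V by rewrite -[_ *m _]/(A ^+ 2) Vx // !inE eqxx !orbT.
have V3 : A *m (A *m A) \in V.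
  by rewrite -[_ *m _]/(A ^+ 3) Vx // !inE eqxx !orbT.
rewrite !mulE !(mulmxBl, mulmxBr, mul_scalar_mx, mul_mx_scalar, scalerBr).
by rewrite -!scalemxAr ?mul_mx_scalar !(memvB, memvZ).
Qed.

(* Hoffman's polynomial: [B := \prod_(b <- s) (A - b)] satisfies [B A = k B],
   so its rows are constant, and so are its columns since [B] is symmetric. *)
Lemma adjacency_prod_const (h : 'I_#|T|) (s : seq R) :
  k%:R \notin s -> \prod_(b <- k%:R :: s) (A - b%:M) = 0 ->
  exists2 c, c != 0 & \prod_(b <- s) (A - b%:M) = const_mx c.
Proof.
move=> ks; rewrite big_cons; set B := \prod_(b <- s) _ => AB0.
have commA r : A *m \prod_(b <- r) (A - b%:M) = \prod_(b <- r) (A - b%:M) *m A.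
  elim: r => [|b r IHr]; first by rewrite big_nil mul1mx mulmx1.
  rewrite big_cons -[X in _ = X *m _]/(_ *m _) -mulmxA -IHr !mulmxA.
  by congr (_ *m _); rewrite mulmxBl mulmxBr scalar_mxC.
have BA : B *m A = k%:R *: B.
  apply/eqP; rewrite -subr_eq0 -commA -mul_scalar_mx -mulmxBl.
  exact/eqP.
have B_tr : B^T = B.
  rewrite /B; elim: (s) => [|b r IHr]; first by rewrite big_nil trmx1.
  rewrite big_cons -[X in X^T]/(_ *m _) trmx_mul IHr raddfB /= tr_scalar_mx.
  by rewrite adjacency_trmx mulmxBr -commA scalar_mxC -mulmxBl.
have B_row i j j' : B i j = B i j'.
  have := @adjacency_eigenvector_const (row i B) j j'; rewrite !mxE; apply.
  by rewrite -row_mul BA; apply/rowP => l; rewrite !mxE.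
have B_col i i' j : B i j = B i' j by rewrite -B_tr !mxE; apply: B_row.
exists (B h h).
  apply/eqP => Bh0.
  have B0 : B = 0.
    by apply/matrixP => i j; rewrite (B_col i h) (B_row h j h) Bh0 mxE.
  (* The all-ones row vector is scaled by [B] by the product of the [k - b], which is nonzero as [k]
     is not in [s]. *)
  have := mul_eigenvector_prod s adjacency_const1; rewrite -/B B0 mulmx0.
  move/rowP/(_ h)/esym/eqP; rewrite !mxE mulr1 prodf_seq_eq0 => /hasP[b bs].
  by rewrite /= subr_eq0 => /eqP kb; rewrite kb bs in ks.
by apply/matrixP => i j; rewrite mxE (B_col i h) (B_row h j h).
Qed.

(** * Classes of vertex pairs *)

(** The boolean lets (i) and (ii), which exchange adjacency and nonadjacency, be treated by one
    argument. *)
Definition colour_rel (b : bool) : rel T := if b then e else nonadjacent e.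

(** The diagonal needs its own value: otherwise it would merge with the nonadjacent pairs having [k]
    common neighbours. *)
Definition pair_class (x y : T) : option (bool * nat) :=
  if x == y then None else Some (e x y, cn x y).

Local Notation key :=
  (fun i j : 'I_#|T| => pair_class (enum_val i) (enum_val j)).

Lemma colour_relE b x y : colour_rel b x y = (x != y) && (e x y == b).
Proof.
case: b => /=; last by rewrite eqbF_neg.
by rewrite eqb_id; have [->|_] := eqVneq x y; rewrite ?e_irr.
Qed.

Lemma pair_class_colour b x y :
  colour_rel b x y -> pair_class x y = Some (b, cn x y).
Proof. by rewrite colour_relE /pair_class => /andP[/negPf-> /eqP->]. Qed.

Lemma pair_class_attained c :
  (exists x y, pair_class x y = c) -> exists i j, key i j = c.
Proof.
by case=> x [y xy]; exists (enum_rank x), (enum_rank y); rewrite !enum_rankK.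
Qed.

Lemma level_pair_class_None : level_mx R key None = 1%:M.
Proof.
apply/matrixP => i j; rewrite !mxE -(inj_eq enum_val_inj) /pair_class.
by have [|] := eqVneq (enum_val i) (enum_val j).
Qed.

Definition colour_mx (b : bool) : 'M[R]_#|T| :=
  \matrix_(i, j) (colour_rel b (enum_val i) (enum_val j))%:R.

Lemma colour_mxN b :
  colour_mx (~~ b) = const_mx 1 - 1%:M - colour_mx b.
Proof.
apply/matrixP => i j; rewrite !mxE !colour_relE (inj_eq enum_val_inj).
by case: eqP => _; case: b; case: (e _ _); rewrite /= ?subr0 ?subrr.
Qed.

(** * Graphs with four eigenvalues *)

Section FourEigenvalues.
Variable s : seq R.
Hypotheses (ks : uniq (k%:R :: s)) (s3 : size s = 3%N).
Hypothesis eigA : forall a, eigenvalue A a <-> a \in k%:R :: s.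

Lemma span4_const1 : const_mx 1 \in V.
Proof.
have /andP[ks' _] := ks.
have prod0 := symmetric_eigenvalue_prod0 adjacency_trmx (fun a => (eigA a).1).
(* A nonzero eigenvector is used only to obtain an index [h], that is, a vertex. *)
have /eigenvalueP[v _ /rV0Pn[h _]] := (eigA k%:R).2 (mem_head _ _).
have [c c0 Bc] := adjacency_prod_const h ks' prod0.
suff -> : const_mx 1 = c^-1 *: const_mx c :> 'M[R]_#|T|.
  by rewrite -Bc memvZ ?span4_prod.
by apply/matrixP => i j; rewrite !mxE mulVf.
Qed.

Lemma span4_colour_mx b : colour_mx b \in V.
Proof.
have VA : colour_mx true \in V.
  by apply: memv_span; rewrite !inE eqxx orbT.
case: b => //; rewrite (colour_mxN true) !memvB ?span4_const1 //.
by apply: memv_span; rewrite mem_head.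
Qed.

(** An off-diagonal class is cut out of one colour by the value of [A ^+ 2], so interpolation
    applies. *)
Lemma hadamard_closed_pair_class c :
  hadamard_closed V -> level_mx R key c \in V.
Proof.
move=> Vhad; case: c => [[b c]|].
  have VA2 : A ^+ 2 \in V by apply: memv_span; rewrite !inE eqxx !orbT.
  have := hadamard_closed_level c%:R Vhad span4_const1 VA2 (span4_colour_mx b).
  set M := \matrix_(i, j) _; suff -> : level_mx R key (Some (b, c)) = M by [].
  apply/matrixP => i j; rewrite [LHS]mxE [RHS]mxE adjacency_sqrE eqr_nat mxE.
  rewrite colour_relE /pair_class.
  have [_|_] /= := eqVneq (enum_val i) (enum_val j); first by rewrite mul0r.
  by rewrite -natrM mulnb.
have V1 : 1%:M \in V by apply: memv_span; rewrite mem_head.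
by rewrite level_pair_class_None.
Qed.

Lemma adjacency_sqr_two_constants (l m : nat) :
  (forall x y, e x y -> cn x y = l) ->
  (forall x y, nonadjacent e x y -> cn x y = m) ->
  A ^+ 2 = k%:R *: 1%:M + l%:R *: A + m%:R *: (const_mx 1 - 1%:M - A).
Proof.
move=> lE mE; apply/matrixP => i j; rewrite adjacency_sqrE !mxE.
rewrite -(inj_eq enum_val_inj); set x := enum_val i; set y := enum_val j.
have [->|xy] := eqVneq x y.
  by rewrite e_irr common_neighbours_refl !subr0 subrr !mulr0 mulr1 !addr0.
have [exy|exy] := boolP (e x y).
  by rewrite lE // subr0 subrr !mulr0 mulr1 add0r addr0.
by rewrite mE ?/nonadjacent /= ?xy // !subr0 !mulr0 mulr1 !add0r.
Qed.

(* Otherwise the eigenvalues other than [k] are three roots of a quadratic. *)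
Lemma not_both_constant :
  constant_on e cn -> constant_on (nonadjacent e) cn -> False.
Proof.
move=> [l lE] [m mE]; have A2 := adjacency_sqr_two_constants lE mE.
have quad t : t \in s -> t ^+ 2 = (l%:R - m%:R) * t + (k%:R - m%:R).
  move=> ts; have : t \in k%:R :: s by rewrite inE ts orbT.
  case/eigA/eigenvalueP=> v vA v0.
  have kt : k%:R != t.
    by apply: contraTneq ks => ->; rewrite /= ts.
  (* Eigenvectors for eigenvalues other than [k] are orthogonal to the all-ones vector, so the
     all-ones term of [A ^+ 2] disappears on [v]. *)
  have v1 : v *m const_mx 1 = 0 :> 'rV_#|T|.
    have Au : A *m const_mx 1 = k%:R *: const_mx 1 :> 'M_#|T|.
      apply/matrixP => i j; rewrite !mxE mulr1 -(adjacency_row_sum i).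
      by apply: eq_bigr => h _; rewrite [X in _ * X]mxE mulr1.
    have : v *m A *m const_mx 1 = t *: (v *m const_mx 1) :> 'rV_#|T|.
      by rewrite vA scalemxAl.
    rewrite -mulmxA Au -scalemxAr => /eqP; rewrite -subr_eq0 -scalerBl.
    by rewrite scaler_eq0 subr_eq0 (negPf kt) => /eqP.
  have := congr1 (mulmx v) A2; rewrite expr2 -[A * A]/(A *m A) mulmxA vA.
  rewrite -scalemxAl vA !mulmxDr -!scalemxAr mulmx1 vA !mulmxDr v1 !mulmxN.
  rewrite mulmx1 vA add0r => /eqP; rewrite scalerA -expr2 -subr_eq0.
  rewrite (_ : _ - _ = (t ^+ 2 - ((l%:R - m%:R) * t + (k%:R - m%:R))) *: v).
    by rewrite scaler_eq0 (negPf v0) orbF subr_eq0 => /eqP.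
  by apply/rowP => i; rewrite !mxE; ring.
move: s3 ks quad; case: (s) => [|x [|y [|z []]]] //= _ /and4P[_ xs yz _] quad.
move: xs yz; rewrite !inE negb_or => /andP[xy xz] yz.
have qx := quad x (mem_head _ _).
have qy : y ^+ 2 = (l%:R - m%:R) * y + (k%:R - m%:R).
  by apply: quad; rewrite !inE eqxx orbT.
have qz : z ^+ 2 = (l%:R - m%:R) * z + (k%:R - m%:R).
  by apply: quad; rewrite !inE eqxx !orbT.
(* Two distinct roots of the quadratic have the linear coefficient as their sum, so
   [x + y = x + z]. *)
have sum (u w : R) : u != w -> u ^+ 2 = (l%:R - m%:R) * u + (k%:R - m%:R) ->
    w ^+ 2 = (l%:R - m%:R) * w + (k%:R - m%:R) -> u + w = l%:R - m%:R.
  rewrite -subr_eq0 => uw qu qw; apply: (mulfI uw).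
  by rewrite -subr_sqr qu qw; ring.
have := sum _ _ xy qx qy; rewrite -(sum _ _ xz qx qz) => /addrI yz'.
by rewrite yz' eqxx in yz.
Qed.

Lemma dim_span4 : (\dim V <= 4)%N.
Proof. exact: dim_span. Qed.

(** Since [\dim V <= 4], four nonempty classes with indicators in [V] suffice. The existence
    hypothesis makes the class of colour [~~ b] nonempty, as [constant_on] also holds vacuously. *)
Lemma two_values_hadamard_closed b :
  (exists x y, colour_rel (~~ b) x y) ->
  constant_on (colour_rel (~~ b)) cn -> takes_two_values_on (colour_rel b) cn ->
  hadamard_closed V.
Proof.
move=> [x0 [y0 xy0]] [m mE] [p [q [pq vals]]].
have bN : (b == ~~ b) = false by case: (b).
pose cs := [:: None; Some (~~ b, m); Some (b, p); Some (b, q)].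
have [x1 [y1 [xy1 p1]]] := (vals p).2 (or_introl erefl).
have [x2 [y2 [xy2 q2]]] := (vals q).2 (or_intror erefl).
have V1 : 1%:M \in V by apply: memv_span; rewrite mem_head.
have VA2 : A ^+ 2 \in V by apply: memv_span; rewrite !inE eqxx !orbT.
have cnE x y : colour_rel b x y -> cn x y = p \/ cn x y = q.
  by move=> xy; apply/vals; exists x, y.
have levelm : level_mx R key (Some (~~ b, m)) = colour_mx (~~ b).
  apply/matrixP => i j; rewrite !mxE colour_relE.
  set x := enum_val i; set y := enum_val j; rewrite /pair_class.
  have [_|xy] := eqVneq x y => //=; congr (_%:R); congr nat_of_bool.
  have [exy|exy] := eqVneq (e x y) (~~ b); last first.
    by apply/eqP => -[exyN _]; rewrite exyN eqxx in exy.
  by rewrite exy mE ?eqxx // colour_relE xy exy eqxx.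
(* Stated for any [c] and [d] to serve both orders of [p] and [q]. The combination of matrices below
   vanishes on the diagonal, on the other colour and on the class of [d], and equals [c - d] on the
   class of [c]. *)
have Vlevel c d : c <> d ->
    (forall x y, colour_rel b x y -> cn x y = c \/ cn x y = d) ->
    level_mx R key (Some (b, c)) \in V.
  move=> cd cdE; have cdR : c%:R - d%:R != 0 :> R.
    by rewrite subr_eq0 eqr_nat; apply/eqP.
  suff -> : level_mx R key (Some (b, c)) = (c%:R - d%:R)^-1 *:
      (A ^+ 2 - k%:R *: 1%:M - m%:R *: colour_mx (~~ b) - d%:R *: colour_mx b).
    by rewrite memvZ // !memvB ?memvZ ?span4_colour_mx.
  apply/matrixP => i j; set x := enum_val i; set y := enum_val j.
  have A2 := adjacency_sqrE i j; rewrite -/x -/y in A2.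
  move: (A ^+ 2) A2 => B A2; rewrite !mxE -/x -/y A2 !colour_relE /pair_class.
  rewrite -(inj_eq enum_val_inj) -/x -/y.
  have [<-|xy] /= := eqVneq x y.
    by rewrite common_neighbours_refl mulr1 subrr !mulr0 !subr0 mulr0.
  have [exy|exy] := eqVneq (e x y) b.
    rewrite exy bN !mulr0 mulr1 !subr0.
    have [|->|->] := cdE x y; first by rewrite colour_relE xy exy eqxx.
      by rewrite eqxx mulVf.
    rewrite subrr mulr0; by case: eqP => // -[/esym].
  have exy' : e x y = ~~ b by move: exy; case: (e x y); case: (b).
  rewrite mE ?colour_relE ?xy exy' ?eqxx // !mulr0 mulr1 !subr0 subrr mulr0.
  by rewrite -[_ == _]/((~~ b == b) && (m == c)) eq_sym bN.
refine (@level_hadamard_closed _ _ _ key V cs _ _ _ _).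
- by rewrite /= !inE; case: (b) => /=; rewrite ?andbT; apply/eqP => -[].
- move=> c; rewrite !inE => /or4P[] /eqP->; apply: pair_class_attained.
  + by exists x0, x0; rewrite /pair_class eqxx.
  + by exists x0, y0; rewrite (pair_class_colour xy0) mE.
  + by exists x1, y1; rewrite (pair_class_colour xy1) p1.
  + by exists x2, y2; rewrite (pair_class_colour xy2) q2.
- move=> c; rewrite !inE => /or4P[] /eqP->.
  + by rewrite level_pair_class_None.
  + by rewrite levelm span4_colour_mx.
  + exact: Vlevel pq cnE.
  + apply: (Vlevel q p) => [/esym//|x y /cnE[]]; by [left|right].
- exact: dim_span4.
Qed.

(** The diagonal class uses up one of the at most four dimensions of [V]. *)
Lemma hadamard_closed_le3 (cs : seq (bool * nat)) :
  hadamard_closed V -> (0 < #|T|)%N -> uniq cs ->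
  (forall c, c \in cs -> exists x y, colour_rel c.1 x y /\ cn x y = c.2) ->
  (size cs <= 3)%N.
Proof.
move=> Vhad /card_gt0P[x _] Ucs att.
have /leq_trans/(_ dim_span4) : (size (None :: map Some cs) <= \dim V)%N.
  apply: (size_level_le_dim (key := key)).
  - rewrite /= map_inj_uniq ?Ucs ?andbT; last by move=> ? ? [].
    by apply/mapP => -[].
  - move=> c c_in; apply: pair_class_attained; move: c_in; rewrite inE.
    case/predU1P=> [->|/mapP[[b a] /att[y [z /= [yz <-]]] ->]].
      by exists x, x; rewrite /pair_class eqxx.
    by exists y, z; rewrite (pair_class_colour yz).
  - by move=> c _; apply: hadamard_closed_pair_class.
by rewrite /= size_map.
Qed.

(** Two values on each colour would give four off-diagonal classes. *)
Lemma hadamard_closed_constantV :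
  hadamard_closed V -> (exists x y, e x y) -> (exists x y, nonadjacent e x y) ->
  constant_on e cn \/ constant_on (nonadjacent e) cn.
Proof.
move=> Vhad [x [y xy]] [z [w zw]].
have [|[x' [y' [xy' x'y']]]] := constant_onVneq e cn (cn x y); first by left.
have [|[z' [w' [zw' z'w']]]] := constant_onVneq (nonadjacent e) cn (cn z w).
  by right.
suff : (size [:: (true, cn x y); (true, cn x' y');
                 (false, cn z w); (false, cn z' w')] <= 3)%N by [].
apply: hadamard_closed_le3 => //; first by apply/card_gt0P; exists x.
  rewrite /= !inE !xpair_eqE !eqxx /= andbT orbF eq_sym.
  by move/eqP: x'y' => /negPf->; rewrite eq_sym; apply/eqP.
by move=> c; rewrite !inE => /or4P[] /eqP->;
  [exists x, y|exists x', y'|exists z, w|exists z', w'].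
Qed.

(** A single value is excluded by [not_both_constant]; a third value, with the class of the other
    colour, would give four off-diagonal classes. *)
Lemma hadamard_closed_two_values b :
  hadamard_closed V -> (exists x y, colour_rel b x y) ->
  (exists x y, colour_rel (~~ b) x y) ->
  constant_on (colour_rel (~~ b)) cn -> takes_two_values_on (colour_rel b) cn.
Proof.
move=> Vhad [x [y xy]] [z [w zw]] const.
have [const'|[x' [y' [xy' x'y']]]] :=
  constant_onVneq (colour_rel b) cn (cn x y).
  by case: b const const' {xy zw}; move=> *; exfalso; apply: not_both_constant.
exists (cn x y), (cn x' y'); split; first exact/nesym.
move=> v; split=> [[x2 [y2 [xy2 <-]]]|[]->]; last 2 first.
- by exists x, y.
- by exists x', y'.
have [|neq] := eqVneq (cn x2 y2) (cn x y); first by left.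
have [|neq'] := eqVneq (cn x2 y2) (cn x' y'); first by right.
suff : (size [:: (b, cn x y); (b, cn x' y'); (b, cn x2 y2); (~~ b, cn z w)]
        <= 3)%N by [].
apply: hadamard_closed_le3 => //; first by apply/card_gt0P; exists x.
  have bN : (b == ~~ b) = false by case: (b).
  rewrite /= !inE !xpair_eqE !eqxx bN /= !orbF andbT negb_or.
  by rewrite ![cn _ _ == cn x2 y2]eq_sym neq neq' eq_sym; move/eqP: x'y' => ->.
by move=> c; rewrite !inE => /or4P[] /eqP->;
  [exists x, y|exists x', y'|exists x2, y2|exists z, w].
Qed.

End FourEigenvalues.
End RegularGraph.

Theorem theorem1p6 (R : rcfType) (T : finType) (e : rel T)
    (A := adjacency_matrix R e)
    (e_simple : simple_graph e) (e_conn : connected_graph e)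
    (e_reg : regular_graph e) (e_diam : diameter e = 2%N)
    (A_eig : num_distinct_eigenvalues A 4) :
  hadamard_closed <<[:: 1%:M; A; A ^+ 2; A ^+ 3]>>%VS
  <->
  ((constant_on (nonadjacent e) (common_neighbours e) /\
    takes_two_values_on e (common_neighbours e))
   \/
   (constant_on e (common_neighbours e) /\
    takes_two_values_on (nonadjacent e) (common_neighbours e))).
Proof.
case: e_simple => e_sym e_irr; case: e_reg => k e_regk.
have ex_nadj : exists x y, nonadjacent e x y.
  by apply: diameter_gt1; rewrite e_diam.
(* The first edge of a path joining two distinct vertices. *)
have ex_adj : exists x y, e x y.
  case: ex_nadj => x [y /andP[xy _]].
  have /connectP[[|z p] /= xp yE] := e_conn x y; first by rewrite yE eqxx in xy.
  by exists x, z; case/andP: xp.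
have ex_rel b : exists x y, colour_rel e b x y by case: b.
have [s [Us s4 eigA]] := A_eig.
have ks : k%:R \in s.
  apply/eigA/eigenvalueP; exists (const_mx 1).
    exact: adjacency_const1 e_sym e_regk.
  case: ex_adj => x _; apply/eqP => /rowP/(_ (enum_rank x))/eqP.
  by rewrite !mxE oner_eq0.
(* The list of eigenvalues is reordered with [k] first, as the preceding lemmas expect. *)
pose s' := rem k%:R s; have s'E := perm_to_rem ks.
have Us' : uniq (k%:R :: s') by rewrite -(perm_uniq s'E).
have s'3 : size s' = 3%N by rewrite size_rem // s4.
have eigA' a : eigenvalue A a <-> a \in k%:R :: s'.
  by rewrite -(perm_mem s'E); apply: eigA.
have two_values b := @hadamard_closed_two_values _ _ _ _ e_sym e_irr e_conn
  e_regk _ Us' s'3 eigA' b.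
have closed b := @two_values_hadamard_closed _ _ _ _ e_sym e_irr e_conn
  e_regk _ Us' s'3 eigA' b.
split=> [Vhad|[[const two]|[const two]]].
- have [const|const] := hadamard_closed_constantV e_sym e_irr e_conn e_regk
    Us' s'3 eigA' Vhad ex_adj ex_nadj.
  + by right; split=> //; apply: (two_values false).
  + by left; split=> //; apply: (two_values true).
- exact: (closed true (ex_rel false)).
- exact: (closed false (ex_rel true)).
Qed.
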